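(* Let $-\infty<t_1<t_2<+\infty$, $b>1$, and let $z\in\mathbb C^{\rm up}$ satisfy $$\Bigl|z-\frac{t_1+t_2}2\Bigr|\ge b\,\frac{t_2-t_1}2 .$$ Then $$\omega(z,[t_1,t_2])\ge\frac{b-1}{2\pi b}\,\frac{(t_2-t_1)\operatorname{Im}z}{|z|^2-\operatorname{Re}z\,(t_1+t_2)+t_1t_2}\ge\frac{b-1}{2\pi b}\,\frac{(t_2-t_1)\operatorname{Im}z}{(|z|+|t_1|)(|z|+|t_2|)} .$$
   Context: $\mathbb C^{\rm up}=\{\operatorname{Im}z>0\}$. Harmonic measure of the upper half-plane: $\omega(z,B)=\frac1\pi\int_{B\cap\mathbb R}\frac{\operatorname{Im}z}{(t-\operatorname{Re}z)^2+(\operatorname{Im}z)^2}\,dt$ for $z\in\mathbb C^{\rm up}$ and Borel $B$. *)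

(* Defs.v *)
From HB Require Import structures.
From mathcomp Require Import all_boot all_order all_algebra.
From mathcomp Require Import all_classical all_reals all_analysis.
From mathcomp Require Export complex.

Set Implicit Arguments.
Unset Strict Implicit.
Unset Printing Implicit Defensive.

Import Order.TTheory GRing.Theory Num.Theory.
Import numFieldNormedType.Exports.

Local Open Scope classical_set_scope.
Local Open Scope complex_scope.
Local Open Scope ring_scope.

(* The library's norm on R[i] takes its values in R[i]; this is the modulus
   as an element of R. *)
Notation cmod := ComplexField.Normc.normc.

Definition upper_half_plane (R : realType) : set R[i] :=
  [set z | 0 < complex.Im z].

(* A subset of R, regarded as a subset of the complex plane. *)
Definition complex_of_real_set (R : realType) (A : set R) : set R[i] :=
  [set t%:C | t in A].

(* B is a subset of the complex plane; the integral ranges over its trace on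
   the real line. *)
Definition harmonic_measure (R : realType) (z : R[i]) (B : set R[i]) : \bar R :=
  ((pi^-1)%:E *
   \int[lebesgue_measure]_(t in [set t : R | B t%:C])
     (complex.Im z / ((t - complex.Re z) ^+ 2 + (complex.Im z) ^+ 2))%:E)%E.

(* Main.v *)
(* Every point of [t1, t2] is within cmod (z - c) + r of z, where c is the
   centre and r the half-length of the interval. Bounding the Poisson kernel
   below by its value at that distance loses a factor (rho - r) / (rho + r)
   against 1 / (rho ^ 2 - r ^ 2), with rho = cmod (z - c) >= b r, and
   2 (rho - r) / (rho + r) >= 2 (b - 1) / (b + 1) >= (b - 1) / b. The
   denominator in the theorem is exactly rho ^ 2 - r ^ 2. *)

Require Import Defs.
From HB Require Import structures.
From mathcomp Require Import all_boot all_order all_algebra.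
From mathcomp Require Import all_classical all_reals all_analysis.
From mathcomp Require Import complex.
From mathcomp Require Import measurable_realfun ring lra.

Set Implicit Arguments.
Unset Strict Implicit.
Unset Printing Implicit Defensive.

Import Order.TTheory GRing.Theory Num.Theory.
Import numFieldNormedType.Exports.

Local Open Scope classical_set_scope.
Local Open Scope complex_scope.
Local Open Scope ring_scope.

Lemma cmod_ge0 (R : rcfType) (z : R[i]) : 0 <= cmod z.
Proof. by case: z => x y /=; exact: sqrtr_ge0. Qed.

Lemma sqr_cmod (R : rcfType) (z : R[i]) :
  cmod z ^+ 2 = complex.Re z ^+ 2 + complex.Im z ^+ 2.
Proof. by case: z => x y /=; rewrite sqr_sqrtr // addr_ge0 ?sqr_ge0. Qed.

Lemma normr_Re_le_cmod (R : rcfType) (z : R[i]) : `|complex.Re z| <= cmod z.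
Proof.
rewrite -[leRHS]ger0_norm ?cmod_ge0 // -ler_sqr ?nnegrE //.
by rewrite !real_normK ?num_real // sqr_cmod lerDl sqr_ge0.
Qed.

(** The embedding of the reals is injective, so the integral in [harmonic_measure] of an embedded
    interval runs over the real interval itself. *)
Lemma preimage_complex_of_real_set (R : realType) (A : set R) :
  [set t : R | complex_of_real_set A t%:C] = A.
Proof.
apply/seteqP; split=> [t [s As [<-]]|t At] //.
by exists t.
Qed.

Lemma harmonic_measure_itv_ge (R : realType) (t1 t2 k : R) (z : R[i]) :
  t1 <= t2 -> upper_half_plane z -> 0 <= k ->
  (forall t, t1 <= t <= t2 ->
     k <= complex.Im z / ((t - complex.Re z) ^+ 2 + complex.Im z ^+ 2)) ->
  ((pi^-1 * (k * (t2 - t1)))%:E <=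
    harmonic_measure z (complex_of_real_set `[t1, t2]))%E.
Proof.
rewrite /upper_half_plane /= => t12 y0 k0 kle.
rewrite /harmonic_measure preimage_complex_of_real_set EFinM.
have y2 : 0 < complex.Im z ^+ 2 by rewrite exprn_gt0.
have den0 (t : R) : 0 < (t - complex.Re z) ^+ 2 + complex.Im z ^+ 2.
  by rewrite ltr_wpDl ?sqr_ge0.
apply: lee_wpmul2l; first by rewrite lee_fin invr_ge0 pi_ge0.
have -> : ((k * (t2 - t1))%:E =
    \int[lebesgue_measure]_(t in `[t1, t2]) (cst k%:E t))%E.
  rewrite integral_cst //= lebesgue_measure_itv /= lte_fin.
  (* The length of an interval is given by cases on [t1 < t2]; in the other case [t1 = t2] and both
     sides vanish. *)
  have [_|t21] := ltP t1 t2; first by rewrite -EFinB -EFinM.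
  by rewrite (@le_anti _ _ t1 t2) ?t12 // subrr mulr0 mule0.
apply: ge0_le_integral => //=.
(* What remains is measurability of the Poisson kernel. It is continuous on the whole line, because
   [den0] keeps its denominator from vanishing. *)
apply/measurable_EFinP; apply: measurable_funTS.
apply: continuous_measurable_fun => t.
apply: cvgM; first exact: cvg_cst.
apply: cvgV; first by rewrite gt_eqF.
apply: cvgD; last exact: cvg_cst.
apply: (@cvg_comp _ _ _ (fun s => s - complex.Re z) (fun s => s ^+ 2));
  last exact: exprn_continuous.
by apply: cvgB => //; exact: cvg_cst.
Qed.

Lemma half_gap_ratio (R : realFieldType) (b r rho : R) :
  1 < b -> 0 < r -> b * r <= rho ->
  (b - 1) / b / (rho ^+ 2 - r ^+ 2) <= 2 / (rho + r) ^+ 2.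
Proof.
move=> b1 r0 brho.
have b0 : 0 < b by lra.
have rrho : r < rho by nra.
rewrite subr_sqr -mulrA -invfM ler_pdivrMr; last first.
  by rewrite !mulr_gt0 //; lra.
rewrite mulrAC ler_pdivlMr; last by rewrite exprn_gt0 //; lra.
rewrite -subr_ge0.
(* Apart from the factor [rho + r], the difference is affine in [rho] with slope [b + 1]; expanding
   it at the extreme value [rho = b * r] leaves the square term [(b - 1) ^+ 2 * r]. *)
have -> : 2 * (b * ((rho - r) * (rho + r))) - (b - 1) * (rho + r) ^+ 2
  = (rho + r) * ((b + 1) * (rho - b * r) + (b - 1) ^+ 2 * r) by ring.
by apply: mulr_ge0; [lra|apply: addr_ge0; apply: mulr_ge0; nra].
Qed.

Theorem mainTheorem9 (R : realType) (t1 t2 b : R) (z : R[i])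
    (ht : t1 < t2) (hb : 1 < b) (hz : upper_half_plane z)
    (hdist : b * ((t2 - t1) / 2) <= cmod (z - ((t1 + t2) / 2)%:C)) :
  (((b - 1) / (2 * pi * b) *
     ((t2 - t1) * complex.Im z /
       (cmod z ^+ 2 - complex.Re z * (t1 + t2) + t1 * t2)))%:E
    <= harmonic_measure z (complex_of_real_set `[t1, t2]))%E /\
  (b - 1) / (2 * pi * b) *
     ((t2 - t1) * complex.Im z / ((cmod z + `|t1|) * (cmod z + `|t2|)))
    <= (b - 1) / (2 * pi * b) *
     ((t2 - t1) * complex.Im z /
       (cmod z ^+ 2 - complex.Re z * (t1 + t2) + t1 * t2)).
Proof.
have y0 : 0 < complex.Im z := hz.
have b0 : 0 < b by lra.
have pi0 : 0 < pi :> R := pi_gt0 R.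
set c := (t1 + t2) / 2 in hdist; set r := (t2 - t1) / 2 in hdist.
set w := z - c%:C in hdist; set rho := cmod w in hdist.
have r0 : 0 < r by rewrite divr_gt0 // subr_gt0.
have t21 : t2 - t1 = r * 2 by rewrite /r; field.
have rrho : r < rho by nra.
have Rew : complex.Re w = complex.Re z - c by rewrite /w; case: (z).
have Imw : complex.Im w = complex.Im z by rewrite /w; case: (z) => ? ? /=; ring.
have rho2 : rho ^+ 2 = (complex.Re z - c) ^+ 2 + complex.Im z ^+ 2.
  by rewrite sqr_cmod Rew Imw.
(* Complete the square, using [2 * c = t1 + t2] and [c ^+ 2 - r ^+ 2 = t1 * t2]. *)
have denE : cmod z ^+ 2 - complex.Re z * (t1 + t2) + t1 * t2
    = rho ^+ 2 - r ^+ 2.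
  by rewrite rho2 sqr_cmod /c /r; field.
have den0 : 0 < rho ^+ 2 - r ^+ 2.
  by rewrite subr_sqr mulr_gt0 //; lra.
split.
- rewrite denE.
  apply: le_trans (@harmonic_measure_itv_ge _ _ _
    (complex.Im z / (rho + r) ^+ 2) _ (ltW ht) hz _ _).
  + rewrite lee_fin.
    (* Both sides are regrouped to share the factors [pi^-1] and [complex.Im z * r]; what is left is
       [half_gap_ratio]. *)
    have -> : (b - 1) / (2 * pi * b) *
        ((t2 - t1) * complex.Im z / (rho ^+ 2 - r ^+ 2)) =
        pi^-1 * (complex.Im z * r * ((b - 1) / b / (rho ^+ 2 - r ^+ 2))).
      rewrite t21; move: (pi : R) pi0 => p p0.
      by field; rewrite !gt_eqF.
    have -> : complex.Im z / (rho + r) ^+ 2 * (t2 - t1) =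
        complex.Im z * r * (2 / (rho + r) ^+ 2).
      by rewrite t21; field; rewrite gt_eqF //; lra.
    apply: ler_wpM2l; first by rewrite invr_ge0 ltW.
    apply: ler_wpM2l; first by rewrite mulr_ge0 // ltW.
    exact: half_gap_ratio.
  + by rewrite divr_ge0 ?sqr_ge0 // ltW.
  + move=> t /andP[t1t tt2].
    apply: ler_wpM2l; first exact: ltW.
    have y2 : 0 < complex.Im z ^+ 2 by rewrite exprn_gt0.
    rewrite lef_pV2 ?posrE; last 2 first.
    * by rewrite exprn_gt0 //; lra.
    * by rewrite ltr_wpDl ?sqr_ge0.
    have tc : `|t - c| <= r by rewrite ler_norml /c /r; lra.
    (* The triangle inequality in squared form: expand the squared distance from [t] to [z] about
       the centre [c]. The cross term contributes at most [2 * r * rho] and [(t - c) ^+ 2] at most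
       [r ^+ 2], which adds up to [(rho + r) ^+ 2]. *)
    have -> : (t - complex.Re z) ^+ 2 + complex.Im z ^+ 2 =
        (t - c) ^+ 2 - 2 * ((t - c) * complex.Re w) + rho ^+ 2.
      by rewrite rho2 Rew; ring.
    have : `|(t - c) * complex.Re w| <= r * rho.
      by rewrite normrM ler_pM // normr_Re_le_cmod.
    rewrite ler_norml => /andP[+ _].
    have : (t - c) ^+ 2 <= r ^+ 2.
      by rewrite -real_normK ?num_real // ler_sqr ?nnegrE // ltW.
    by rewrite sqrrD; lra.
- have c0 : 0 <= (b - 1) / (2 * pi * b).
    by apply: divr_ge0; [lra|rewrite !mulr_ge0 //; lra].
  apply: (ler_wpM2l c0); apply: ler_wpM2l.
    by rewrite mulr_ge0 ?subr_ge0 // ltW.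
  (* Expand the product on the right and compare term by term; [xt] handles the two terms linear in
     [complex.Re z]. *)
  have denle : cmod z ^+ 2 - complex.Re z * (t1 + t2) + t1 * t2 <=
      (cmod z + `|t1|) * (cmod z + `|t2|).
    have xt (t : R) : - (complex.Re z * t) <= cmod z * `|t|.
      apply: le_trans (ler_norm _) _.
      by rewrite normrN normrM ler_wpM2r // normr_Re_le_cmod.
    have t12 : t1 * t2 <= `|t1| * `|t2| by rewrite -normrM ler_norm.
    by move: (xt t1) (xt t2) t12; rewrite !mulrDr !mulrDl; lra.
  move: denle; rewrite denE => denle.
  by rewrite lef_pV2 ?posrE // (lt_le_trans den0).
Qed.
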